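(* Let $G=(V,D,B)$ be an acyclic mixed graph with $V=[m]$, and let $$\phi_G:\mathbb{R}^D\times \mathit{PD}(B)\to \mathit{PD}(m),\qquad \phi_G(\Lambda,\Omega)=(I-\Lambda)^{-T}\,\Omega\,(I-\Lambda)^{-1}.$$ Then $\phi_G$ fails to be injective if and only if there is a subset $A\subseteq V$ such that the induced subgraph $G_A=(A,D_A,B_A)$ has the property that its directed part $(A,D_A)$ contains a converging arborescence and its bidirected part $(A,B_A)$ is connected. Moreover, if $\phi_G$ is injective, then its inverse (defined on the image of $\phi_G$) is a rational map.
   Context: A mixed graph is a triple $G=(V,D,B)$ with $V$ a finite node set, here $V=[m]:=\{1,\dots,m\}$, and $D,B\subseteq V\times V$. Elements $(i,j)\in D$ are directed edges $i\to j$. $B$ is symmetric, and its elements are bidirected edges $i\leftrightarrow j$. There are no self-loops. $G$ is acyclic if $(V,D)$ has no directed cycles (a pair may be joined by both a directed and a bidirected edge). $\mathbb{R}^D$ is the set of real $m\times m$ matrices $\Lambda=(\lambda_{ij})$ with $\lambda_{ij}=0$ whenever $(i,j)\notin D$; for acyclic $G$, $I-\Lambda$ is invertible for all $\Lambda\in\mathbb{R}^D$. $\mathit{PD}(m)$ is the cone of real symmetric positive definite $m\times m$ matrices; $\mathit{PD}(B)$ is the set of $\Omega=(\omega_{ij})\in \mathit{PD}(m)$ with $\omega_{ij}=0$ whenever $i\neq j$ and $(i,j)\notin B$. $M^{-T}$ denotes the transpose of $M^{-1}$. For $A\subseteq V$: $D_A=D\cap(A\times A)$, $B_A=B\cap(A\times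 A)$, $G_A=(A,D_A,B_A)$. A directed graph with at least two nodes is an arborescence converging to node $i$ if its edges form a spanning tree with a directed path from every node $j\neq i$ to $i$. $(A,D_A)$ contains a converging arborescence if, for some $i\in A$, some subset of $D_A$ forms, on node set $A$, an arborescence converging to $i$ (in particular $|A|\ge 2$). $(A,B_A)$ is connected if it is connected as an undirected graph on $A$. That the inverse is a rational map means that the entries of $(\Lambda,\Omega)$ are given by rational functions of the entries of $\Sigma=\phi_G(\Lambda,\Omega)$. *)

(* Defs.v *)
(* MathComp, with the abstract reals [realType] of MathComp-Analysis and the
   multivariate polynomials of multinomials. *)
From mathcomp Require Import all_boot all_order all_algebra.
From mathcomp Require Import classical_sets functions reals.
From mathcomp Require Import mpoly.

Set Implicit Arguments.
Unset Strict Implicit.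
Unset Printing Implicit Defensive.

Import Order.TTheory GRing.Theory Num.Theory.
Local Open Scope ring_scope.
Local Open Scope classical_set_scope.

Section Graphs.
Variable V : finType.
Implicit Types (A : {set V}) (E T : {set V * V}).

Record mixed_graph := MixedGraph {
  directed : {set V * V};
  bidirected : {set V * V};
  directed_noloop : forall i, (i, i) \notin directed;
  bidirected_noloop : forall i, (i, i) \notin bidirected;
  bidirected_sym : forall i j,
    (i, j) \in bidirected -> (j, i) \in bidirected }.

Definition edge_rel E : rel V := fun i j => (i, j) \in E.

Definition undirected_rel E : rel V :=
  fun i j => ((i, j) \in E) || ((j, i) \in E).

Definition acyclic (G : mixed_graph) : Prop :=
  forall c : seq V, cycle (edge_rel (directed G)) c -> c = [::].

Definition induced_edges E A : {set V * V} := E :&: finset.setX A A.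

(* In the next three definitions the pair [A], [E] (or [A], [T]) stands for the
   graph with node set [A] and edge set contained in [A x A]. *)
Definition connected_graph A E : Prop :=
  {in A &, forall i j, connect (undirected_rel E) i j}.

(* Tree = connected without undirected cycles. The third clause excludes the
   cycles of length one and two (loops and pairs of antiparallel edges), the
   last one the simple cycles of length at least three. *)
Definition spanning_tree A T : Prop :=
  [/\ T \subset finset.setX A A,
      connected_graph A T,
      forall i j, (i, j) \in T -> (j, i) \notin T
    & forall c : seq V, (2 < size c)%N -> ~~ ucycleb (undirected_rel T) c].

Definition arborescence_converging_to A T (i : V) : Prop :=
  [/\ (2 <= #|A|)%N, i \in A, spanning_tree A T
    & forall j, j \in A -> j != i -> connect (edge_rel T) j i].

Definition contains_converging_arborescence A E : Prop :=
  exists i T, T \subset E /\ arborescence_converging_to A T i.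

End Graphs.

Section Parametrization.
Variables (R : realType) (m : nat).
Implicit Types (D B : {set 'I_m * 'I_m}) (M : 'M[R]_m).

Definition posdefmx M : Prop :=
  M^T = M /\ forall x : 'cV[R]_m, x != 0 -> 0 < (x^T *m M *m x) 0 0.

Definition coef_space D : set 'M[R]_m :=
  [set Lambda | forall i j, (i, j) \notin D -> Lambda i j = 0].

Definition cov_space B : set 'M[R]_m :=
  [set Omega | posdefmx Omega /\
    forall i j, i != j -> (i, j) \notin B -> Omega i j = 0].

Definition param_space (G : mixed_graph 'I_m) : set ('M[R]_m * 'M[R]_m) :=
  coef_space (directed G) `*` cov_space (bidirected G).

(* The formula does not involve the graph, which only enters through
   [param_space]. On the parameter space of an acyclic graph [1%:M - Lambda]
   is invertible, so [invmx] is the genuine inverse there. *)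
Definition sem_map (theta : 'M[R]_m * 'M[R]_m) : 'M[R]_m :=
  let: (Lambda, Omega) := theta in
  (invmx (1%:M - Lambda))^T *m Omega *m invmx (1%:M - Lambda).

(* A rational function of the [m * m] entries of a matrix, with a single
   fraction valid on all of [S]: its denominator vanishes nowhere on [S]. The
   variable of index [mxvec_index i j] stands for the entry [(i, j)]. *)
Definition rational_on (S : set 'M[R]_m) (f : 'M[R]_m -> R) : Prop :=
  exists p q : {mpoly R[m * m]}, forall Sigma, S Sigma ->
    q.@[mxvec Sigma 0] != 0 /\
    f Sigma = p.@[mxvec Sigma 0] / q.@[mxvec Sigma 0].

Definition rational_inverse (G : mixed_graph 'I_m) : Prop :=
  exists psi : 'M[R]_m -> 'M[R]_m * 'M[R]_m,
    (forall theta, param_space G theta -> psi (sem_map theta) = theta) /\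
    forall i j,
      rational_on (sem_map @` param_space G) (fun Sigma => (psi Sigma).1 i j) /\
      rational_on (sem_map @` param_space G) (fun Sigma => (psi Sigma).2 i j).

End Parametrization.

Arguments param_space R {m} G _.
Arguments sem_map {R m} theta.
Arguments rational_inverse R {m} G.

(* Main.v *)
Require Import Defs.
From mathcomp Require Import all_boot all_order all_algebra.
From mathcomp Require Import classical_sets functions reals.
From mathcomp Require Import boolp mpoly.
From mathcomp Require Import fintype finset.

Set Implicit Arguments.
Unset Strict Implicit.
Unset Printing Implicit Defensive.

Import Order.TTheory GRing.Theory Num.Theory.

(** Order the nodes by [depth], the number of their ancestors. If [Lambda] is
    known on the columns of smaller depth, the equations [Omega i k = 0] for the
    non-siblings [i] of [k] of smaller depth are linear in column [k] of
    [Lambda]. If this system always has full column rank, solving its normal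
    equations column by column inverts [sem_map] by rational functions. A kernel
    vector [v] at [(Lambda, Omega)] yields, by positivity of [Omega], an
    obstruction on [k] and the support of [w = (1 - Lambda)^-1 v]. Conversely,
    given an obstruction [A] with root [k], the indicator [w] of [A :\ k] comes
    from such a kernel vector, when [Lambda] follows one outgoing edge per node
    and [Omega] is the graph Laplacian of the bidirected part of [A], grounded
    at [k]; changing column [k] of [Lambda] along [(1 - Lambda) w] then gives a
    second parameter with the same image. *)

(** * Ancestor counts and converging arborescences in acyclic graphs *)

Section Graphs.
Variables (V : finType) (G : mixed_graph V).
Hypothesis acyclicG : acyclic G.
Implicit Types (A : {set V}) (i j k : V).

Definition depth i : nat :=
  #|[set j | connect (edge_rel (directed G)) j i]|.

Lemma depth_edge i j : (i, j) \in directed G -> (depth i < depth j)%N.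
Proof.
move=> ij; apply/proper_card/properP; split.
  apply/subsetP=> l; rewrite !inE => li.
  exact: connect_trans li (connect1 _).
(* [j] is its own ancestor, while a path from [j] to [i] would close a cycle. *)
exists j; rewrite inE ?connect0 //; apply/connectP=> -[p jp ip].
have := acyclicG (c := j :: p).
by rewrite /= rcons_path jp -ip /edge_rel ij => /(_ isT).
Qed.

(** Induction from the sinks backwards along directed edges; it is well founded because [depth] is
    bounded by [#|V|]. *)
Lemma depth_gt_ind (P : V -> Prop) :
  (forall i, (forall j, (depth i < depth j)%N -> P j) -> P i) ->
  forall i, P i.
Proof.
move=> IH i; have [n le_n] := ubnP (#|V| - depth i).
elim: n i le_n => // n IHn i le_n.
apply: IH => j ij; apply: IHn; rewrite -ltnS; apply: leq_trans le_n.
by rewrite ltnS ltn_sub2l // (leq_trans ij) // max_card.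
Qed.

Lemma depth_lt_ind (P : V -> Prop) :
  (forall i, (forall j, (depth j < depth i)%N -> P j) -> P i) ->
  forall i, P i.
Proof.
move=> IH i; have [n] := ubnP (depth i); elim: n i => // n IHn i le_n.
by apply: IH => j ji; apply: IHn; apply: leq_trans ji _.
Qed.

Lemma undirected_rel_sym (E : {set V * V}) :
  connect_sym (undirected_rel E).
Proof. by apply: sym_connect_sym => i j; rewrite /undirected_rel orbC. Qed.

Lemma connected_graph_root A (E : {set V * V}) k :
  {in A, forall i, connect (undirected_rel E) i k} -> connected_graph A E.
Proof.
move=> Ak i j iA jA; apply: connect_trans (Ak i iA) _.
by rewrite undirected_rel_sym Ak.
Qed.

(** Local form of convergence to [k]: in an acyclic graph, following such edges raises [depth], so a
    walk inside [A] can only stop at [k]. *)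
Definition flows_to A k :=
  forall i, i \in A -> i != k -> exists2 j, j \in A & (i, j) \in directed G.

Lemma flows_to_next A k : flows_to A k ->
  exists next : V -> V, forall i, i \in A -> i != k ->
    next i \in A /\ (i, next i) \in directed G.
Proof.
move=> Ak; exists (fun i => odflt i [pick j in A | (i, j) \in directed G]).
move=> i iA ik; case: pickP => [j /andP[]//|no].
by have [j jA ij] := Ak i iA ik; have := no j; rewrite jA ij.
Qed.

(** An arborescence gives each node other than the root a first edge towards it. Conversely, one
    chosen outgoing edge per such node forms a tree, since [depth] increases along these edges. *)
Lemma contains_converging_arborescenceP A :
  contains_converging_arborescence A (induced_edges (directed G) A) <->
  (1 < #|A|)%N /\ exists2 k, k \in A & flows_to A k.
Proof.
split=> [[k [T [TE [A2 kA _ Tk]]]]|[A2 [k kA Ak]]].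
  split=> //; exists k => // i iA ik.
  have /connectP[[|j p] /= ijp ek] := Tk i iA ik.
    by rewrite -ek eqxx in ik.
  have /andP[ij _] := ijp.
  have := subsetP TE _ ij; rewrite !inE /= => /and3P[Dij _ jA].
  by exists j.
have [next nextP] := flows_to_next Ak.
pose T := [set (i, next i) | i in A :\ k].
have TP i j : (i, j) \in T -> [/\ i \in A, i != k & j = next i].
  by case/imsetP=> l; rewrite !inE => /andP[lk lA] [-> ->].
have Tdepth i j : (i, j) \in T -> (depth i < depth j)%N.
  by case/TP=> iA ik ->; apply/depth_edge; case: (nextP i iA ik).
have Tk j : j \in A -> connect (edge_rel T) j k.
  elim/depth_gt_ind: j => j IH jA; have [->|jk] := eqVneq j k.
    exact: connect0.
  have [nA jn] := nextP j jA jk; apply: connect_trans (IH _ (depth_edge jn) nA).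
  by apply: connect1; apply/imsetP; exists j => //; rewrite !inE jk.
exists k, T; split; last split=> //.
- apply/subsetP=> -[i j] /TP[iA ik ->]; rewrite !inE iA /=.
  by have [-> ->] := nextP i iA ik.
- split.
  + apply/subsetP=> -[i j] /TP[iA ik ->]; rewrite !inE iA /=.
    by have [] := nextP i iA ik.
  + apply: (@connected_graph_root _ _ k) => i iA.
    have := Tk i iA; apply: connect_sub => x y xy.
    by apply: connect1; rewrite /undirected_rel -[_ \in T]/(edge_rel T x y) xy.
  + by move=> i j /Tdepth ij; apply/negP => /Tdepth /ltnW; rewrite leqNgt ij.
  (* Both neighbours of a cycle node of minimal depth would be its successor. *)
  + move=> c c3; apply/negP=> /andP[ec uc].
    have [x0 x0c] : exists x0, x0 \in c.
      by case: c c3 {ec uc} => // x c _; exists x; rewrite inE eqxx.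
    case: (arg_minnP (P := mem c) depth x0c) => x xc xmin.
    have [n p rp] := rot_to xc.
    have up y : y \in c -> undirected_rel T x y -> y = next x.
      move=> yc /orP[/TP[]//|/Tdepth yx].
      by have := xmin y yc; rewrite leqNgt yx.
    move: ec uc c3; rewrite -(rot_cycle n) -(rot_uniq n) -(size_rot n) rp.
    have pc y : y \in x :: p -> y \in c by rewrite -rp mem_rot.
    (* The rotated cycle reads [x, y, ..., z], where [y] and [z] are distinct because its length is
       at least three. *)
    case: p {rp} pc => [|y p] // pc; case/lastP: p pc => [|p z] // pc.
    rewrite /= rcons_path last_rcons => /andP[xy /andP[_ zx]].
    have -> : y = next x by apply: up => //; apply: pc; rewrite !inE eqxx orbT.
    have -> : z = next x.
      apply: up; last by rewrite /undirected_rel orbC.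
      by apply: pc; rewrite !inE mem_rcons inE eqxx !orbT.
    by rewrite mem_rcons inE eqxx !andbF.
- by move=> j jA _; apply: Tk.
Qed.

End Graphs.

Local Open Scope ring_scope.

(** * Invertibility, positive definiteness and normal equations *)

Section LinearAlgebra.

Lemma unitmx_ker0 (F : fieldType) n (A : 'M[F]_n) :
  (forall x : 'cV_n, A *m x = 0 -> x = 0) -> A \in unitmx.
Proof.
move=> kerA; rewrite -unitmx_tr -row_free_unit; apply: inj_row_free => v vA.
apply: trmx_inj; rewrite trmx0; apply: kerA.
by rewrite -[A]trmxK -trmx_mul vA trmx0.
Qed.

Lemma unitmx_mul_neq0 (F : fieldType) n (A : 'M[F]_n) (x : 'cV_n) :
  A \in unitmx -> x != 0 -> A *m x != 0.
Proof.
by move=> uA; apply: contra_neq => Ax; rewrite -[x](mulKmx uA) Ax mulmx0.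
Qed.

Variables (R : realType) (n : nat).
Implicit Types (M P Q : 'M[R]_n) (x y b : 'cV[R]_n).

Lemma posdefmx_congr M P :
  posdefmx M -> P \in unitmx -> posdefmx (P^T *m M *m P).
Proof.
case=> symM posM uP; split; first by rewrite !trmx_mul trmxK symM mulmxA.
move=> x x0; have := posM (P *m x) (unitmx_mul_neq0 uP x0).
by rewrite trmx_mul !mulmxA.
Qed.

Lemma dotmx_ge0 x : 0 <= (x^T *m x) 0 0.
Proof. by rewrite mxE sumr_ge0 // => i _; rewrite !mxE -expr2 sqr_ge0. Qed.

Lemma dotmx_eq0 x : (x^T *m x) 0 0 = 0 -> x = 0.
Proof.
rewrite mxE => x0; apply/colP=> i; rewrite mxE; apply/eqP; rewrite -sqrf_eq0.
have := psumr_eq0P _ x0 (i := i); rewrite mxE -expr2 => -> // j _.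
by rewrite mxE -expr2 sqr_ge0.
Qed.

(** Matrix of the normal equations for the system with blocks [P] and [Q] stacked. *)
Definition gram P Q := P^T *m P + Q^T *m Q.

(** The quadratic form of [gram P Q] at [x] is the sum of the squared norms of [P x] and [Q x]. *)
Lemma gram_unitmx P Q :
  (forall x, P *m x = 0 -> Q *m x = 0 -> x = 0) -> gram P Q \in unitmx.
Proof.
move=> kerPQ; apply: unitmx_ker0 => x gx.
have : (x^T *m (gram P Q *m x)) 0 0 = 0 by rewrite gx mulmx0 mxE.
have -> : x^T *m (gram P Q *m x)
    = (P *m x)^T *m (P *m x) + (Q *m x)^T *m (Q *m x).
  by rewrite /gram mulmxDl mulmxDr !trmx_mul !mulmxA.
rewrite mxE => /eqP; rewrite paddr_eq0 ?dotmx_ge0 //.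
by case/andP=> /eqP/dotmx_eq0 ? /eqP/dotmx_eq0; apply: kerPQ.
Qed.

Lemma gram_solve P Q b y : gram P Q \in unitmx ->
  P *m y = b -> Q *m y = 0 -> y = invmx (gram P Q) *m (P^T *m b).
Proof.
move=> ug Py Qy; rewrite -[LHS](mulKmx ug); congr (_ *m _).
by rewrite mulmxDl -!mulmxA Py Qy mulmx0 addr0.
Qed.

End LinearAlgebra.

(** * Obstructions and the linear system for one column of [Lambda] *)

Section Identification.
Variables (R : realType) (m : nat) (G : mixed_graph 'I_m).
Hypothesis acyclicG : acyclic G.
Implicit Types (Lambda Omega Sigma : 'M[R]_m) (A : {set 'I_m}) (k : 'I_m).
Local Notation D := (directed G).
Local Notation B := (bidirected G).

Definition obstruction A :=
  contains_converging_arborescence A (induced_edges D A) /\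
  connected_graph A (induced_edges B A).

(** Without an out-neighbour of [i] in the support of [x], entry [i] of [(1 - Lambda) x] is just
    [x i 0]. *)
Lemma coef_space_support Lambda (x : 'cV[R]_m) i :
  coef_space D Lambda -> x i 0 != 0 ->
  ((1%:M - Lambda) *m x) i 0 != 0 \/ exists2 j, x j 0 != 0 & (i, j) \in D.
Proof.
move=> DL xi.
have [[j xj ij]|no] := pselect (exists2 j, x j 0 != 0 & (i, j) \in D).
  by right; exists j.
left; rewrite mulmxBl mul1mx !mxE big1 ?subr0 // => j _.
have [->|xj] := eqVneq (x j 0) 0; first by rewrite mulr0.
by rewrite DL ?mul0r //; apply/negP => ij; apply: no; exists j.
Qed.

(** From every node in the support of a kernel vector an edge leads to another such node, which
    acyclicity forbids. *)
Lemma coef_space_unitmx Lambda :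
  coef_space D Lambda -> 1%:M - Lambda \in unitmx.
Proof.
move=> DL; apply: unitmx_ker0 => x x0; apply/eqP/negPn/negP => /cV0Pn[i].
elim/(@depth_gt_ind _ G): i => i IH /(coef_space_support DL)[|[j xj ij]].
  by rewrite x0 mxE eqxx.
exact: IH (depth_edge acyclicG ij) xj.
Qed.

Lemma sem_mapK Lambda Omega : coef_space D Lambda ->
  (1%:M - Lambda)^T *m sem_map (Lambda, Omega) *m (1%:M - Lambda) = Omega.
Proof.
move=> /coef_space_unitmx uL.
by rewrite /sem_map !mulmxA -trmx_mul mulVmx // trmx1 mul1mx mulmxKV.
Qed.

(** Row [i] of the left side involves only column [i] of [Lambda]; this makes a column-by-column
    recovery possible. *)
Lemma mul_sem_map Lambda Omega : coef_space D Lambda ->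
  (1%:M - Lambda)^T *m sem_map (Lambda, Omega)
    = Omega *m invmx (1%:M - Lambda).
Proof.
move=> DL; rewrite -{2}(sem_mapK Omega DL) mulmxK //.
exact: coef_space_unitmx.
Qed.

(* [A] is the support of [(1 - Lambda)^-1 v] together with [k]. A bidirected
   component [C] of the support that does not meet the siblings of [k] would
   make [Omega] singular on [C]. *)
Lemma obstruction_of_kernel Lambda Omega k (v : 'cV[R]_m) :
  param_space R G (Lambda, Omega) -> v != 0 ->
  (forall i, v i 0 != 0 -> (i, k) \in D) ->
  (forall i, (depth G i < depth G k)%N -> (i, k) \notin B ->
     (Omega *m invmx (1%:M - Lambda) *m v) i 0 = 0) ->
  exists A, obstruction A.
Proof.
case=> /= DL [[symO posO] BO] v0 vk kerv.
have uL := coef_space_unitmx DL.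
set w := invmx (1%:M - Lambda) *m v.
have Uw : (1%:M - Lambda) *m w = v by rewrite mulKVmx.
have w0 : w != 0 by rewrite unitmx_mul_neq0 // unitmx_inv.
pose S := [set i | w i 0 != 0].
have Snext i : i \in S -> (i, k) \in D \/ exists2 j, j \in S & (i, j) \in D.
  rewrite inE => /(coef_space_support DL)[|[j wj ij]].
    by rewrite Uw => /vk; left.
  by right; exists j; rewrite ?inE.
(* Edges within [S] lead on until one enters [k], so all of [S] lies at smaller depth than [k]. *)
have Sk i : i \in S -> (depth G i < depth G k)%N.
  elim/(@depth_gt_ind _ G): i => i IH /Snext[/(depth_edge acyclicG)//|[j jS]].
  by move=> /(depth_edge acyclicG) ij; apply: ltn_trans ij (IH _ ij jS).
have kS : k \notin S by apply/negP => /Sk; rewrite ltnn.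
have [s0 s0S] : exists i, i \in S.
  by have /cV0Pn[i] := w0; exists i; rewrite inE.
exists (k |: S); split.
  apply/(contains_converging_arborescenceP acyclicG); split.
    by rewrite cardsU1 kS (cardsD1 s0) s0S.
  exists k => [|i]; first by rewrite !inE eqxx.
  rewrite in_setU1 => /orP[->//|iS] _.
  have [ik|[j jS ij]] := Snext i iS; first by exists k => //; rewrite !inE eqxx.
  by exists j => //; rewrite in_setU1 jS orbT.
pose e := undirected_rel (induced_edges B (k |: S)).
apply: (@connected_graph_root _ _ _ k) => i; rewrite in_setU1.
have [->|ik /= iS] := eqVneq i k; first by rewrite connect0.
rewrite -/e; apply/negPn/negP => nik.
(* If [i] is not joined to [k], the restriction [x] of [w] to the component [C] of [i] will satisfy
   [x^T Omega x = 0]. *)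
pose C := [set j in S | connect e i j].
pose x : 'cV[R]_m := \col_j (if j \in C then w j 0 else 0).
have Be j l : j \in k |: S -> l \in k |: S -> (j, l) \in B -> connect e j l.
  move=> jA lA jl; apply: connect1.
  by rewrite /e /undirected_rel in_setI in_setX jl jA lA.
have x0 : x != 0.
  by apply/cV0Pn; exists i; rewrite mxE inE iS connect0; rewrite inE in iS.
have := posO x x0; rewrite -mulmxA mxE big1 ?ltxx // => j _.
rewrite !mxE; case: ifPn => [jC|]; last by rewrite mul0r.
have /andP[jS ij] : (j \in S) && connect e i j by rewrite inE in jC.
(* On the rows of [C], [Omega x] agrees with [Omega w], as no bidirected edge joins [C] to the rest
   of [S]. Row [j] of [Omega w] vanishes by [kerv], since [j] is not a sibling of [k]. *)
suff -> : \sum_l Omega j l * x l 0 = 0 by rewrite mulr0.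
rewrite -[RHS](kerv j (Sk j jS)).
  rewrite -mulmxA -/w mxE; apply: eq_bigr => l _; rewrite mxE.
  case: ifPn => // lC; rewrite mulr0.
  have [->|wl] := eqVneq (w l 0) 0; first by rewrite mulr0.
  have lS : l \in S by rewrite inE.
  rewrite BO ?mul0r //; first by apply: contraNneq lC => <-.
  apply/negP=> jl; move/negP: lC; apply; rewrite inE lS.
  by apply: connect_trans ij (Be _ _ _ _ jl); rewrite in_setU1 ?jS ?lS orbT.
apply/negP=> jk; move/negP: nik; apply.
by apply: connect_trans ij (Be _ _ _ _ jk); rewrite in_setU1 ?jS ?eqxx ?orbT.
Qed.

(** Vectors supported on the parents of [k] are encoded as the fixed vectors of this projection,
    which keeps all systems of size [m]. *)
Definition parent_proj k : 'M[R]_m := diag_mx (\row_i ((i, k) \in D)%:R).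

(* The equations for column [k] of [Lambda] that involve, besides [Sigma], only
   columns of smaller depth: those stating that [Omega i k = 0]. *)
Definition column_system k Lambda Sigma : 'M[R]_m :=
  \matrix_(i, j) if (depth G i < depth G k)%N && ((i, k) \notin B)
                 then ((1%:M - Lambda)^T *m Sigma) i j else 0.

(** The second block imposes support on the parents of [k]. *)
Definition column_gram k Lambda Sigma : 'M[R]_m :=
  gram (column_system k Lambda Sigma *m parent_proj k) (1%:M - parent_proj k).

Definition column_solution k Lambda Sigma : 'cV[R]_m :=
  invmx (column_gram k Lambda Sigma) *m
  ((column_system k Lambda Sigma *m parent_proj k)^T *m
   col k (column_system k Lambda Sigma)).

Lemma column_systemE k Lambda Omega p (x : 'M[R]_(m, p)) i j :
  coef_space D Lambda ->
  (column_system k Lambda (sem_map (Lambda, Omega)) *m x) i j =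
  if (depth G i < depth G k)%N && ((i, k) \notin B)
  then (Omega *m invmx (1%:M - Lambda) *m x) i j else 0.
Proof.
move=> DL; rewrite mxE -(mul_sem_map _ DL); case: ifP => ik.
  by rewrite [RHS]mxE; apply: eq_bigr => l _; rewrite mxE ik.
by rewrite big1 // => l _; rewrite mxE ik mul0r.
Qed.

Lemma column_system_ext k Lambda1 Lambda2 Sigma :
  (forall j, (depth G j < depth G k)%N -> col j Lambda1 = col j Lambda2) ->
  column_system k Lambda1 Sigma = column_system k Lambda2 Sigma.
Proof.
move=> L12; apply/matrixP=> i j; rewrite !mxE; case: ifP => // /andP[ik _].
apply: eq_bigr => l _; rewrite !mxE.
by have /colP/(_ l) := L12 i ik; rewrite !mxE => ->.
Qed.

Lemma parent_proj_fix k (x : 'cV[R]_m) :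
  (forall i, x i 0 != 0 -> (i, k) \in D) <-> parent_proj k *m x = x.
Proof.
split=> [xk|xk i].
  apply/colP=> i; rewrite mul_diag_mx !mxE.
  have [->|/xk ->] := eqVneq (x i 0) 0; first by rewrite mulr0.
  by rewrite mul1r.
by rewrite -{1}xk mul_diag_mx !mxE; case: (_ \in _) => //; rewrite mul0r eqxx.
Qed.

Hypothesis unobstructed : ~ exists A, obstruction A.

(** A common kernel vector of both blocks is supported on the parents of [k] and meets the
    hypotheses of [obstruction_of_kernel]. *)
Lemma column_gram_unitmx k theta : param_space R G theta ->
  column_gram k theta.1 (sem_map theta) \in unitmx.
Proof.
case: theta => Lambda Omega th /=; have [DL _] := th.
apply: gram_unitmx => x Nx /eqP.
rewrite mulmxBl mul1mx subr_eq0 => /eqP/esym Fx.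
apply/eqP/negPn/negP => x0; apply: unobstructed.
have [_ /(_ Fx) xk] := parent_proj_fix k x.
apply: (obstruction_of_kernel th x0 xk) => i ik iB.
move/colP: Nx => /(_ i).
by rewrite -mulmxA Fx column_systemE // ik iB [in RHS]mxE.
Qed.

Lemma column_solutionE k theta : param_space R G theta ->
  col k theta.1 = column_solution k theta.1 (sem_map theta).
Proof.
move=> th; have ug := column_gram_unitmx k th.
case: theta th ug => Lambda Omega [/= DL [posO BO]] ug.
have Fk : parent_proj k *m col k Lambda = col k Lambda.
  apply/parent_proj_fix => i; rewrite mxE; apply: contraNT => /DL ->.
  by rewrite eqxx.
apply: gram_solve => //; last by rewrite mulmxBl mul1mx Fk subrr.
rewrite -mulmxA Fk; apply/eqP; rewrite eq_sym -subr_eq0; apply/eqP.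
set N := column_system _ _ _.
(* Column [k] of [N (1 - Lambda)] has as its nonzero rows only entries [Omega i k] with [i] a
   non-sibling of smaller depth, and these vanish too. *)
have -> : col k N - N *m col k Lambda = col k (N *m (1%:M - Lambda)).
  by rewrite mulmxBr mulmx1 !colE mulmxBl mulmxA.
apply/colP=> i; rewrite [LHS]mxE column_systemE // [RHS]mxE.
case: ifP => [/andP[ik iB]|//]; rewrite mulmxKV ?coef_space_unitmx // BO //.
by apply: contraTneq ik => ->; rewrite ltnn.
Qed.

End Identification.

(** * Closure properties of rational functions without poles on [S] *)

Section RationalFunctions.
Variables (R : realType) (m : nat) (S : set 'M[R]_m).
Implicit Types (f g : 'M[R]_m -> R).

Lemma rational_on_ext f g :
  (forall Sigma, S Sigma -> f Sigma = g Sigma) ->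
  rational_on S f -> rational_on S g.
Proof.
move=> fg [p [q pq]]; exists p, q => Sigma SS.
by rewrite -fg //; apply: pq.
Qed.

Lemma rational_on_cst c : rational_on S (fun=> c).
Proof.
by exists c%:MP, 1%:MP => Sigma _; rewrite !mevalC oner_eq0 divr1.
Qed.

Lemma rational_on_entry i j : rational_on S (fun Sigma => Sigma i j).
Proof.
exists 'X_(mxvec_index i j), 1%:MP => Sigma _.
by rewrite mevalC mevalXU mxvecE oner_eq0 divr1.
Qed.

Lemma rational_onD f g :
  rational_on S f -> rational_on S g ->
  rational_on S (fun Sigma => f Sigma + g Sigma).
Proof.
move=> [p [q pq]] [p' [q' pq']]; exists (p * q' + p' * q), (q * q') => Sigma SS.
have [q0 ->] := pq _ SS; have [q'0 ->] := pq' _ SS.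
by rewrite mevalD !mevalM mulf_neq0 // addf_div.
Qed.

Lemma rational_onM f g :
  rational_on S f -> rational_on S g ->
  rational_on S (fun Sigma => f Sigma * g Sigma).
Proof.
move=> [p [q pq]] [p' [q' pq']]; exists (p * p'), (q * q') => Sigma SS.
have [q0 ->] := pq _ SS; have [q'0 ->] := pq' _ SS.
by rewrite !mevalM mulf_neq0 // mulf_div.
Qed.

(** Numerator and denominator swap; the numerator has no zero on [S] because [f] has none. *)
Lemma rational_onV f :
  (forall Sigma, S Sigma -> f Sigma != 0) ->
  rational_on S f -> rational_on S (fun Sigma => (f Sigma)^-1).
Proof.
move=> f0 [p [q pq]]; exists q, p => Sigma SS; have := f0 _ SS.
have [q0 ->] := pq _ SS; rewrite invf_div mulf_eq0 invr_eq0 negb_or.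
by case/andP.
Qed.

Lemma rational_on_sum (I : Type) (r : seq I) (P : pred I)
    (F : I -> 'M[R]_m -> R) :
  (forall i, P i -> rational_on S (F i)) ->
  rational_on S (fun Sigma => \sum_(i <- r | P i) F i Sigma).
Proof.
move=> ratF; elim: r => [|i r IHr].
  by apply: rational_on_ext (rational_on_cst 0) => Sigma _; rewrite big_nil.
have [Pi|Pi] := boolP (P i).
  apply: rational_on_ext (rational_onD (ratF i Pi) IHr) => Sigma _.
  by rewrite big_cons Pi.
by apply: rational_on_ext IHr => Sigma _; rewrite big_cons (negbTE Pi).
Qed.

Lemma rational_on_prod (I : Type) (r : seq I) (F : I -> 'M[R]_m -> R) :
  (forall i, rational_on S (F i)) ->
  rational_on S (fun Sigma => \prod_(i <- r) F i Sigma).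
Proof.
move=> ratF; elim: r => [|i r IHr].
  by apply: rational_on_ext (rational_on_cst 1) => Sigma _; rewrite big_nil.
apply: rational_on_ext (rational_onM (ratF i) IHr) => Sigma _.
by rewrite big_cons.
Qed.

Definition rational_mx p q (F : 'M[R]_m -> 'M[R]_(p, q)) :=
  forall i j, rational_on S (fun Sigma => F Sigma i j).

Lemma rational_mx_cst p q (M : 'M[R]_(p, q)) : rational_mx (fun=> M).
Proof. by move=> i j; apply: rational_on_cst. Qed.

Lemma rational_mx_id : rational_mx id.
Proof. by move=> i j; apply: rational_on_entry. Qed.

Lemma rational_mxD p q (F F' : 'M[R]_m -> 'M[R]_(p, q)) :
  rational_mx F -> rational_mx F' ->
  rational_mx (fun Sigma => F Sigma + F' Sigma).
Proof.
move=> ratF ratF' i j.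
apply: rational_on_ext (rational_onD (ratF i j) (ratF' i j)).
by move=> Sigma _; rewrite mxE.
Qed.

Lemma rational_mxM p q r (F : 'M[R]_m -> 'M[R]_(p, q))
    (F' : 'M[R]_m -> 'M[R]_(q, r)) :
  rational_mx F -> rational_mx F' ->
  rational_mx (fun Sigma => F Sigma *m F' Sigma).
Proof.
move=> ratF ratF' i j.
apply: (@rational_on_ext (fun Sigma => \sum_l F Sigma i l * F' Sigma l j)).
  by move=> Sigma _; rewrite mxE.
by apply: rational_on_sum => l _; apply: rational_onM.
Qed.

Lemma rational_mxT p q (F : 'M[R]_m -> 'M[R]_(p, q)) :
  rational_mx F -> rational_mx (fun Sigma => (F Sigma)^T).
Proof.
by move=> ratF i j; apply: rational_on_ext (ratF j i) => Sigma _; rewrite mxE.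
Qed.

Lemma rational_on_det n (F : 'M[R]_m -> 'M[R]_n) :
  rational_mx F -> rational_on S (fun Sigma => \det (F Sigma)).
Proof.
move=> ratF; apply: rational_on_sum => s _.
by apply: rational_onM (rational_on_cst _) (rational_on_prod _ _) => i.
Qed.

(** By Cramer's rule the entries are cofactors divided by the determinant. *)
Lemma rational_mxV n (F : 'M[R]_m -> 'M[R]_n) :
  (forall Sigma, S Sigma -> F Sigma \in unitmx) ->
  rational_mx F -> rational_mx (fun Sigma => invmx (F Sigma)).
Proof.
move=> uF ratF i j.
apply: (@rational_on_ext
  (fun Sigma => (\det (F Sigma))^-1 * cofactor (F Sigma) j i)).
  by move=> Sigma SS; rewrite /invmx uF // !mxE.
apply: rational_onM.
  apply: rational_onV (rational_on_det ratF) => Sigma SS.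
  by rewrite -unitfE -unitmxE uF.
apply: rational_onM (rational_on_cst _) (rational_on_det _) => a b.
by apply: rational_on_ext (ratF _ _) => Sigma _; rewrite !mxE.
Qed.

End RationalFunctions.

(** * Injectivity and the rational inverse in the absence of obstructions *)

Section Inverse.
Variables (R : realType) (m : nat) (G : mixed_graph 'I_m).
Hypothesis acyclicG : acyclic G.
Hypothesis unobstructed : ~ exists A, obstruction G A.

(** By induction on depth, [Sigma] and the earlier columns determine each column of [Lambda]; then
    [sem_mapK] returns [Omega]. *)
Lemma sem_map_inj : set_inj (param_space R G) sem_map.
Proof.
move=> theta1 theta2 /set_mem th1 /set_mem th2 eS.
have eL : theta1.1 = theta2.1.
  apply/matrixP=> i j; suff /colP/(_ i) : col j theta1.1 = col j theta2.1.
    by rewrite !mxE.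
  elim/(@depth_lt_ind _ G): j => j IH.
  rewrite (column_solutionE acyclicG unobstructed j th1).
  rewrite (column_solutionE acyclicG unobstructed j th2) eS.
  by rewrite /column_solution /column_gram (column_system_ext _ IH).
case: theta1 theta2 th1 th2 eS eL => [L1 O1] [L2 O2] [DL1 _] [DL2 _] eS eL.
rewrite /= in eL DL1 DL2; subst L2.
by rewrite -(sem_mapK acyclicG O1 DL1) -(sem_mapK acyclicG O2 DL2) eS.
Qed.

Lemma sem_map_rational_inverse : rational_inverse R G.
Proof.
(* A preimage is chosen; the default [(0, 0)] is taken only off the image. *)
pose psi (Sigma : 'M[R]_m) := xget (0, 0)
  [set theta | param_space R G theta /\ sem_map theta = Sigma]%classic.
have psiK theta : param_space R G theta -> psi (sem_map theta) = theta.
  move=> th; rewrite /psi; case: xgetP => [th1 _ [th1P e]|/(_ theta)[]//].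
  by apply: sem_map_inj e; apply/mem_set.
exists psi; split=> //.
pose S : set 'M[R]_m := (sem_map @` param_space R G)%classic.
have ratL : rational_mx S (fun Sigma => (psi Sigma).1).
  move=> i k; elim/(@depth_lt_ind _ G): k i => k IH i.
  apply: (@rational_on_ext _ _ _
    (fun Sigma => column_solution G k (psi Sigma).1 Sigma i 0)).
    move=> _ [theta th <-]; rewrite psiK //.
    by rewrite -(column_solutionE acyclicG unobstructed k th) mxE.
  have ratN :
      rational_mx S (fun Sigma => column_system G k (psi Sigma).1 Sigma).
    move=> a b.
    case: (boolP ((depth G a < depth G k)%N && ((a, k) \notin bidirected G)));
      move=> ak; last first.
      apply: rational_on_ext (rational_on_cst _ 0) => Sigma _.
      by rewrite mxE (negbTE ak).
    have [ak1 _] := andP ak.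
    (* Row [a] uses only column [a] of [Lambda], of smaller depth, so the induction hypothesis
       covers it. *)
    apply: (@rational_on_ext _ _ _ (fun Sigma => \sum_l
        ((a == l)%:R + -1 * (psi Sigma).1 l a) * Sigma l b)).
      move=> Sigma _; rewrite mxE ak mxE; apply: eq_bigr => l _.
      by rewrite !mxE eq_sym mulN1r.
    apply: rational_on_sum => l _.
    apply: rational_onM (rational_on_entry _ _ _).
    apply: rational_onD (rational_on_cst _ _) _.
    exact: rational_onM (rational_on_cst _ _) (IH a ak1 l).
  have ratNP :=
    rational_mxM ratN (@rational_mx_cst _ _ _ _ _ (parent_proj R G k)).
  apply: rational_mxM; first apply: rational_mxV.
  - by move=> _ [theta th <-]; rewrite psiK //; apply: column_gram_unitmx.
  - apply: rational_mxD (rational_mx_cst _ _).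
    exact: rational_mxM (rational_mxT ratNP) ratNP.
  - apply: rational_mxM; first exact: rational_mxT ratNP.
    move=> a b.
    by apply: rational_on_ext (ratN a k) => Sigma _; rewrite [RHS]mxE.
move=> a b; split; first exact: ratL.
have ratU : rational_mx S (fun Sigma => 1%:M - (psi Sigma).1).
  move=> i j; apply: rational_on_ext (rational_onD
    (rational_on_cst _ (i == j)%:R)
    (rational_onM (rational_on_cst _ (-1)) (ratL i j))).
  by move=> Sigma _; rewrite !mxE mulN1r.
have ratO :=
  rational_mxM (rational_mxM (rational_mxT ratU) (@rational_mx_id _ _ S)) ratU.
apply: rational_on_ext (ratO a b).
move=> _ [[L O] th <-]; rewrite psiK //=; have [DL _] := th.
by rewrite (sem_mapK acyclicG).
Qed.
End Inverse.

(** * Two parameters with the same image from an obstruction *)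

Section NonInjectivity.
Variables (R : realType) (m : nat) (G : mixed_graph 'I_m).
Hypothesis acyclicG : acyclic G.
Implicit Types (Lambda Omega : 'M[R]_m) (E : {set 'I_m * 'I_m}).
Implicit Types (A S : {set 'I_m}).
Local Notation D := (directed G).
Local Notation B := (bidirected G).

(* Replacing [1 - Lambda] by [(1 - Lambda) (1 + w e_k^T)] and [Omega]
   accordingly leaves [sem_map] unchanged. *)
Lemma not_inj_of_kernel Lambda Omega k (w : 'cV[R]_m) :
  param_space R G (Lambda, Omega) -> w != 0 ->
  (forall i, ((1%:M - Lambda) *m w) i 0 != 0 -> (i, k) \in D) ->
  (forall i, i != k -> (i, k) \notin B -> (Omega *m w) i 0 = 0) ->
  ~ set_inj (param_space R G) sem_map.
Proof.
move=> th w0 wk kerw; have [/= DL [posO BO]] := th.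
pose P : 'M[R]_m := 1%:M + w *m delta_mx 0 k.
pose L := Lambda - (1%:M - Lambda) *m w *m delta_mx 0 k.
have UP : 1%:M - L = (1%:M - Lambda) *m P.
  by rewrite /L /P mulmxDr mulmx1 mulmxA opprB addrCA addrC.
have deltaE (x : 'cV[R]_m) i j : (x *m delta_mx 0 k) i j = x i 0 * (j == k)%:R.
  by rewrite mxE big_ord1 mxE.
have DL' : coef_space D L.
  move=> i j ij; rewrite /L mxE DL // mxE deltaE add0r; apply/eqP.
  rewrite oppr_eq0 mulf_eq0.
  have [ejk|] := eqVneq j k; last by rewrite eqxx orbT.
  by apply: contraNT ij; rewrite negb_or ejk => /andP[/wk].
have uU := coef_space_unitmx acyclicG DL.
(* [P] is a factor of [1 - L], which is invertible by acyclicity. *)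
have uP : P \in unitmx.
  by have := coef_space_unitmx acyclicG DL'; rewrite UP unitmx_mul => /andP[].
have PU : P *m invmx ((1%:M - Lambda) *m P) = invmx (1%:M - Lambda).
  rewrite -[LHS](mulKmx uU) (mulmxA (1%:M - _)) mulmxV ?mulmx1 //.
  by rewrite unitmx_mul uU.
pose O := P^T *m Omega *m P.
have th' : param_space R G (L, O).
  have posO' : posdefmx O by apply: posdefmx_congr.
  (* For [i != k], row [i] of [P^T] is that of the identity, so [O i j] is [Omega i j], plus
     [(Omega w) i] when [j = k]. Row [k] then follows by symmetry. *)
  have O0 i j : i != k -> i != j -> (i, j) \notin B -> O i j = 0.
    move=> ik ij nB; rewrite /O -mulmxA {1}/P linearD /= trmx1 mulmxDl mul1mx.
    rewrite trmx_mul trmx_delta -mulmxA mxE [X in _ + X]mxE big_ord1.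
    rewrite [X in _ + X * _]mxE (negPf ik) mul0r addr0.
    rewrite /P mulmxDr mulmx1 mulmxA mxE deltaE BO // add0r.
    have [ejk|_] := eqVneq j k; last by rewrite mulr0.
    by rewrite ejk in nB; rewrite kerw ?mul0r.
  split=> //=; split=> // i j ij nB.
  have [eik|ik] := eqVneq i k; last exact: O0.
  case: posO' => <- _; rewrite mxE; apply: O0.
  - by rewrite -eik eq_sym.
  - by rewrite eq_sym.
  - by apply: contra nB; apply: bidirected_sym.
move=> inj; have := inj _ _ (mem_set th) (mem_set th').
have -> : sem_map (Lambda, Omega) = sem_map (L, O).
  by rewrite /sem_map UP /O -PU trmx_mul !mulmxA.
move=> /(_ erefl) [eL _]; move/eqP: w0; apply.
have e : (1%:M - Lambda) *m w *m delta_mx 0 k = 0.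
  by apply/eqP; rewrite -oppr_eq0 -(inj_eq (addrI Lambda)) addr0 -/L -eL.
rewrite -[w](mulKmx uU) (_ : _ *m w = 0) ?mulmx0 //.
by apply/colP=> i; have /matrixP/(_ i k) := e; rewrite deltaE eqxx mulr1 !mxE.
Qed.

Definition laplacian E : 'M[R]_m :=
  \matrix_(i, j) ((i == j)%:R * (\sum_l ((i, l) \in E)%:R) - ((i, j) \in E)%:R).

Lemma laplacian_mulE E (x : 'cV[R]_m) i :
  (laplacian E *m x) i 0 = \sum_j ((i, j) \in E)%:R * (x i 0 - x j 0).
Proof.
rewrite mxE; under eq_bigr do rewrite mxE mulrBl.
rewrite sumrB; set d := \sum_l _.
have -> : \sum_j (i == j)%:R * d * x j 0 = d * x i 0.
  rewrite (bigD1 i) //= [X in _ + X]big1 => [|j /negPf ji].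
    by rewrite eqxx mul1r addr0.
  by rewrite eq_sym ji !mul0r.
rewrite mulr_suml -sumrB.
by apply: eq_bigr => j _; rewrite mulrBr.
Qed.

Lemma laplacian_tr E : (forall i j, (i, j) \in E -> (j, i) \in E) ->
  (laplacian E)^T = laplacian E.
Proof.
move=> symE; apply/matrixP=> i j; rewrite !mxE; congr (_ - _).
  by have [->//|_] := eqVneq i j; rewrite !mul0r.
by congr (nat_of_bool _)%:R; apply/idP/idP; apply: symE.
Qed.

(** Averaging the form with its copy under exchange of [i] and [j] completes the squares; the factor
    2 reflects the sum over ordered pairs. *)
Lemma laplacian_form E (x : 'cV[R]_m) :
  (forall i j, (i, j) \in E -> (j, i) \in E) ->
  (x^T *m laplacian E *m x) 0 0 *+ 2 =
  \sum_i \sum_j ((i, j) \in E)%:R * (x i 0 - x j 0) ^+ 2.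
Proof.
move=> symE.
have form : (x^T *m laplacian E *m x) 0 0 =
    \sum_i \sum_j ((i, j) \in E)%:R * (x i 0 * (x i 0 - x j 0)).
  rewrite -mulmxA mxE; apply: eq_bigr => i _.
  rewrite laplacian_mulE mxE mulr_sumr; apply: eq_bigr => j _.
  by rewrite mulrCA.
rewrite mulr2n {1}form exchange_big form -big_split; apply: eq_bigr => i _ /=.
rewrite -big_split; apply: eq_bigr => j _ /=.
have -> : ((j, i) \in E) = ((i, j) \in E) by apply/idP/idP; apply: symE.
by rewrite -mulrDr -[x j 0 - _]opprB mulrN addrC -mulrBl expr2.
Qed.

Definition set_col S : 'cV[R]_m := \col_i (i \in S)%:R.
Definition set_proj S : 'M[R]_m := diag_mx (set_col S)^T.

Lemma set_projE S (x : 'cV[R]_m) i :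
  (set_proj S *m x) i 0 = (i \in S)%:R * x i 0.
Proof. by rewrite mul_diag_mx !mxE. Qed.

(** The Laplacian block on [A :\ k], padded by the identity on all other nodes. *)
Definition reduced_laplacian E A k : 'M[R]_m :=
  (set_proj (A :\ k))^T *m laplacian E *m set_proj (A :\ k) +
  (1%:M - set_proj (A :\ k))^T *m (1%:M - set_proj (A :\ k)).

(** If the form vanishes at [x], then [x] is zero off [A :\ k] and constant along edges;
    connectedness carries the value 0 from [k] to all of [A]. *)
Lemma reduced_laplacian_posdef E A k :
  (forall i j, (i, j) \in E -> (j, i) \in E) ->
  k \in A -> connected_graph A E ->
  posdefmx (reduced_laplacian E A k).
Proof.
move=> symE kA conA; set F := set_proj (A :\ k); split.
  rewrite /reduced_laplacian -/F linearD /= !trmx_mul !trmxK.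
  by rewrite laplacian_tr // mulmxA.
move=> x x0; rewrite -mulmxA mulmxDl mulmxDr mxE.
have -> : x^T *m (F^T *m laplacian E *m F *m x)
    = (F *m x)^T *m laplacian E *m (F *m x) by rewrite trmx_mul !mulmxA.
have -> : x^T *m ((1%:M - F)^T *m (1%:M - F) *m x)
    = ((1%:M - F) *m x)^T *m ((1%:M - F) *m x) by rewrite trmx_mul !mulmxA.
set y := F *m x; set z := (1%:M - F) *m x.
pose q i j := ((i, j) \in E)%:R * (y i 0 - y j 0) ^+ 2.
have q_ge0 i j : 0 <= q i j by rewrite mulr_ge0 // sqr_ge0.
have L2 : _ = \sum_i \sum_j q i j := laplacian_form y symE.
have L_ge0 : 0 <= (y^T *m laplacian E *m y) 0 0.
  rewrite -(pmulrn_lge0 _ (ltn0Sn 1)) L2.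
  by rewrite sumr_ge0 // => i _; rewrite sumr_ge0.
rewrite lt_neqAle addr_ge0 ?dotmx_ge0 // andbT eq_sym paddr_eq0 ?dotmx_ge0 //.
apply/negP=> /andP[/eqP L0 /eqP/dotmx_eq0 z0]; move/eqP: x0; apply.
have -> : x = y.
  by apply/eqP; rewrite -subr_eq0 -[x in x - _]mul1mx -mulmxBl -/z z0.
have ye i j : (i, j) \in E -> y i 0 = y j 0.
  move=> ij; apply/eqP; rewrite -subr_eq0 -sqrf_eq0.
  have q0 : \sum_i \sum_j q i j = 0 by rewrite -L2 L0 mul0rn.
  have qi : \sum_j q i j = 0.
    by apply: (psumr_eq0P _ q0) => // l _; rewrite sumr_ge0.
  have : q i j = 0 by apply: (psumr_eq0P _ qi).
  by rewrite /q ij mul1r => ->.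
apply/colP=> i; rewrite [RHS]mxE.
have [iA|iA] := boolP (i \in A); last first.
  by rewrite set_projE !inE (negPf iA) andbF mul0r.
have -> : 0 = y k 0 by rewrite set_projE !inE eqxx mul0r.
have /connectP[p] := conA i k iA kA.
elim: p i {iA} => [|j p IH] i /= => [_ ->//|/andP[ij /IH jk] /jk <-].
by case/orP: ij => /ye.
Qed.

Lemma obstruction_not_inj A : obstruction G A ->
  ~ set_inj (param_space R G) sem_map.
Proof.
case=> /(contains_converging_arborescenceP acyclicG)[A2 [k kA]].
move=> /flows_to_next[next nextP] conA.
set E := induced_edges B A in conA; set S := A :\ k.
have symE i j : (i, j) \in E -> (j, i) \in E.
  by rewrite !in_setI !in_setX => /andP[/bidirected_sym -> /andP[-> ->]].
pose w := set_col S.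
pose Lambda : 'M[R]_m :=
  \matrix_(i, j) ([&& i \in S, j == next i & j != k])%:R.
have wF : set_proj S *m w = w.
  by apply/colP=> i; rewrite set_projE !mxE -natrM mulnb andbb.
apply: (@not_inj_of_kernel Lambda (reduced_laplacian E A k) k w).
- split=> /=.
    move=> i j ij; rewrite mxE; case: and3P => // -[].
    rewrite !inE => /andP[ik iA] /eqP eij _.
    by have [_] := nextP i iA ik; rewrite -eij (negPf ij).
  split; first exact: reduced_laplacian_posdef.
  move=> i j ij nB; rewrite /reduced_laplacian -/S /set_proj tr_diag_mx.
  rewrite mxE mul_mx_diag mxE mul_diag_mx mxE.
  have -> : laplacian E i j = 0.
    by rewrite mxE (negPf ij) mul0r sub0r in_setI (negPf nB) oppr0.
  rewrite mulr0 mul0r add0r mxE big1 // => l _; rewrite !mxE.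
  have [li|_] := eqVneq l i; last by rewrite !mulr0n subrr mul0r.
  by rewrite li (negPf ij) !mulr0n subrr mulr0.
- apply/cV0Pn; move: A2; rewrite (cardsD1 k) kA -/S ltnS.
  by case/card_gt0P=> i iS; exists i; rewrite mxE iS oner_eq0.
(* For [i] in [S] with no edge to [k], [next i] is again in [S], and the two entries 1 of [w]
   cancel. *)
- move=> i; apply: contraNT => nik; rewrite mulmxBl mul1mx !mxE.
  have [iS|iS] := boolP (i \in S); last first.
    rewrite big1 ?subr0 // => j _; by rewrite !mxE (negPf iS) mul0r.
  move: (iS); rewrite in_setD1 => /andP[ik iA]; have [nA ni] := nextP i iA ik.
  have nk : next i != k by apply: contraNneq nik => <-.
  rewrite (bigD1 (next i)) //= big1 => [|j /negPf jn].
    by rewrite !mxE eqxx iS nk in_setD1 nk nA mulr1 addr0 subrr.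
  by rewrite !mxE jn andbF mul0r.
(* On the indicator of [S], row [i] of the Laplacian with [i] in [S] counts the edges from [i] out
   of [S], and these can only end at [k]. *)
- move=> i ik nB; rewrite /reduced_laplacian -/S mulmxDl -!mulmxA.
  rewrite [_ *m w in X in _ + X]mulmxBl mul1mx wF subrr mulmx0 addr0.
  rewrite /set_proj tr_diag_mx -/(set_proj S) set_projE laplacian_mulE.
  have [iS|] := boolP (i \in S); last by rewrite mul0r.
  rewrite mul1r big1 // => j _; rewrite !mxE iS.
  have [jS|jS] := boolP (j \in S); first by rewrite subrr mulr0.
  have /negPf-> : (i, j) \notin E; last by rewrite mul0r.
  apply: contra nB => /setIP[ij /setXP[_ /= jA]].
  by move: jS; rewrite in_setD1 jA andbT negbK => /eqP <-.
Qed.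
End NonInjectivity.

(** * The equivalence and the rational inverse, assembled *)

Theorem theorem2 (R : realType) (m : nat) (G : mixed_graph 'I_m)
    (acyclicG : acyclic G) :
  (~ set_inj (param_space R G) sem_map <->
     exists A : {set 'I_m},
       contains_converging_arborescence A (induced_edges (directed G) A) /\
       connected_graph A (induced_edges (bidirected G) A)) /\
  (set_inj (param_space R G) sem_map -> rational_inverse R G).
Proof.
split; first split.
- move=> ninj; apply: contrapT => unobstructed; apply: ninj.
  exact: sem_map_inj.
- by case=> A; apply: obstruction_not_inj.
- move=> inj; apply: sem_map_rational_inverse => // -[A obsA].
  exact: obstruction_not_inj obsA inj.
Qed.
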